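(* Let $\mathcal{A}$ be an abelian category with enough injectives (for example, the category of left modules over a ring) and let $F:\mathcal{A}\to\mathbf{Ab}$ be an additive contravariant functor. Consider the left fundamental sequence of $F$, i.e. the sequence of functors and natural transformations $$\cdots\to S_3F\to\underline{F}\circ\Sigma^3\to L^2F\to S_2F\to\underline{F}\circ\Sigma^2\to L^1F\to S_1F\to\underline{F}\circ\Sigma\xrightarrow{\alpha_F}L^0F\xrightarrow{\lambda_F}F\to\underline{F}\to0 .$$ Then: (1) The left fundamental sequence is a complex whose homology is zero except, possibly, at the terms $L^iF$. (2) If $F$ is half-exact, then the sequence is exact. (3) If $F$ carries epimorphisms to monomorphisms, then $\alpha_F$ is monic. (4) If $F$ carries monomorphisms to epimorphisms, then $\underline{F}=0$ and $\lambda_F$ is epic. (5) $\lambda_F$ is an isomorphism if and only if $F$ is right-exact.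
   Context: $\mathbf{Ab}$ is the category of abelian groups. A contravariant additive functor $F$ is half-exact if for each short exact sequence $0\to A\to B\to C\to0$ the sequence $F(C)\to F(B)\to F(A)$ is exact at $F(B)$; it is right-exact if it carries each exact sequence $0\to A\to B\to C$ to an exact sequence $F(C)\to F(B)\to F(A)\to0$. Construction of the left fundamental sequence of a contravariant functor. For an object $B$ choose an injective resolution $0\to B\to I^0\xrightarrow{d_0}I^1\xrightarrow{d_1}\cdots$. Put $\Sigma^0B=B$, let $m_0:B\to I^0$ be the given embedding, and for $i\ge0$ let $e_i:I^i\to\Sigma^{i+1}B$ be the cokernel of $m_i:\Sigma^iB\to I^i$ and $m_{i+1}:\Sigma^{i+1}B\to I^{i+1}$ the monomorphism with $d_i=m_{i+1}e_i$. Define: - $L^iF(B)=\mathrm{Ker}(F(d_{i-1}):F(I^i)\to F(I^{i-1}))/\mathrm{Im}(F(d_i):F(I^{i+1})\to F(I^i))$ (with $\mathrm{Ker}\,F(d_{-1}):=F(I^0)$), the left-derived functors; - the quot-stabilization $\underline{F}(B)=\mathrm{Coker}(F(m_0):F(I^0)\to F(B))$, which equals the cokernel of the canonical map $\lambda_F:L^0F\to F$ induced by $F(m_0)$; since $\underline{F}$ vanishes on injectives, $\underline{F}\circ\Sigma^i$ is a well-defined functor, with $\underline{F}(\Sigma^iB)=\mathrm{Coker}(F(m_i):F(I^i)\to F(\Sigma^iB))$; - the left satellites $S_0F=F$ and, for $i\ge1$, $S_iF(B)=\mathrm{Ker}(F(e_{i-1}):F(\Sigma^iB)\to F(I^{i-1}))$.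 These are independent of the choice of resolution and functorial in $B$. The maps of the sequence, for $i\ge0$, are: $L^iF(B)\to S_iF(B)$ is induced by $F(m_i):F(I^i)\to F(\Sigma^iB)$ (for $i=0$ this is $\lambda_F$); $S_iF(B)\to\underline{F}(\Sigma^iB)$ is the inclusion into $F(\Sigma^iB)$ followed by the projection; $\underline{F}(\Sigma^{i+1}B)\to L^iF(B)$ is induced by $F(e_i):F(\Sigma^{i+1}B)\to F(I^i)$ (for $i=0$ this is $\alpha_F$). *)

(* Defs.v *)
From HB Require Import structures.
From mathcomp Require Import all_boot all_algebra.
From mathcomp Require Import boolp.

Set Implicit Arguments.
Unset Strict Implicit.
Unset Printing Implicit Defensive.

Import GRing.Theory.
Local Open Scope ring_scope.

(* The category Ab is that of [zmodType]s and additive maps.  Classically     *)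
(* (boolp) every abelian group carries a [zmodType] structure.                *)

Section Ker.
Variables (U V : zmodType) (f : {additive U -> V}).

Definition ker_pred : {pred U} := fun x => f x == 0.

Lemma ker_pred_closed : zmod_closed ker_pred.
Proof.
split=> [|x y]; rewrite !unfold_in ?raddf0 //.
by move=> /eqP fx /eqP fy; rewrite raddfB fx fy subr0.
Qed.

HB.instance Definition _ := GRing.isZmodClosed.Build U ker_pred ker_pred_closed.

Record ker := Ker { ker_val : U; _ : ker_pred ker_val }.

HB.instance Definition _ := [isSub for ker_val].
HB.instance Definition _ := [Choice of ker by <:].
HB.instance Definition _ := [SubChoice_isSubZmodule of ker by <:].

Definition ker_inc : {additive ker -> U} := (val : ker -> U).

Lemma ker_incP (x : ker) : f (ker_inc x) = 0.
Proof. by case: x => x /= /eqP. Qed.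

Lemma ker_inc_inj : injective ker_inc.
Proof. exact: val_inj. Qed.

Variables (W : zmodType) (h : {additive W -> U}) (fh0 : forall w, f (h w) = 0).

Lemma ker_lift_proof w : ker_pred (h w).
Proof. by rewrite /ker_pred fh0. Qed.

Definition ker_lift_fun (w : W) : ker := Ker (ker_lift_proof w).

Lemma ker_lift_additive : zmod_morphism ker_lift_fun.
Proof. by move=> x y; apply: val_inj; rewrite /= raddfB. Qed.

HB.instance Definition _ :=
  GRing.isZmodMorphism.Build W ker ker_lift_fun ker_lift_additive.

Definition ker_lift : {additive W -> ker} := ker_lift_fun.

Lemma ker_inc_lift w : ker_inc (ker_lift w) = h w.
Proof. by []. Qed.

End Ker.

Section Coker.
Variables (U V : zmodType) (f : {additive U -> V}).

Definition im_pred : {pred V} := fun y => `[< exists x, f x = y >].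

Lemma im_pred_closed : zmod_closed im_pred.
Proof.
split=> [|_ _ /asboolP[x <-] /asboolP[y <-]].
  by apply/asboolP; exists 0; rewrite raddf0.
by apply/asboolP; exists (x - y); rewrite raddfB.
Qed.

HB.instance Definition _ := GRing.isZmodClosed.Build V im_pred im_pred_closed.

Definition coker : zmodType := Quotient.quot im_pred.

Definition coker_pi : {additive V -> coker} :=
  (\pi_(Quotient.quot im_pred))%qT.

Lemma coker_pi_surj (z : coker) : exists y, coker_pi y = z.
Proof. by exists (repr z); exact: reprK. Qed.

Lemma coker_pi_eq (y y' : V) :
  coker_pi y = coker_pi y' <-> exists x, f x = y - y'.
Proof.
split=> [/eqP|yy']; first by rewrite -Quotient.idealrBE => /asboolP.
by apply/eqP; rewrite -Quotient.idealrBE; apply/asboolP.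
Qed.

Lemma coker_pi_eq0 (y : V) : coker_pi y = 0 <-> exists x, f x = y.
Proof. by rewrite -(raddf0 coker_pi) coker_pi_eq subr0. Qed.

Variables (W : zmodType) (h : {additive V -> W}) (hf0 : forall x, h (f x) = 0).

Definition coker_desc_fun (z : coker) : W :=
  h (@repr _ (Quotient.quot im_pred) z).

Lemma coker_desc_pi_proof (y : V) : coker_desc_fun (coker_pi y) = h y.
Proof.
rewrite /coker_desc_fun; apply/eqP; rewrite -subr_eq0 -raddfB; apply/eqP.
have /coker_pi_eq[x <-] : coker_pi (repr (coker_pi y)) = coker_pi y.
  exact: reprK.
exact: hf0.
Qed.

Lemma coker_desc_additive : zmod_morphism coker_desc_fun.
Proof.
move=> z z'; have [[y <-] [y' <-]] := (coker_pi_surj z, coker_pi_surj z').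
by rewrite -raddfB !coker_desc_pi_proof raddfB.
Qed.

HB.instance Definition _ :=
  GRing.isZmodMorphism.Build coker W coker_desc_fun coker_desc_additive.

Definition coker_desc : {additive coker -> W} := coker_desc_fun.

Lemma coker_desc_pi (y : V) : coker_desc (coker_pi y) = h y.
Proof. exact: coker_desc_pi_proof. Qed.

End Coker.

Definition surjective_map (U V : Type) (f : U -> V) : Prop :=
  forall y, exists x, f x = y.

Definition exact_ab (U V W : zmodType) (f : {additive U -> V})
    (g : {additive V -> W}) : Prop :=
  forall y, g y = 0 <-> exists x, f x = y.

Record preadditive := Preadditive {
  obj :> Type;
  hom : obj -> obj -> zmodType;
  idm : forall A, hom A A;
  comp : forall A B D, hom B D -> hom A B -> hom A D;
  comp1m : forall A B (f : hom A B), comp (idm B) f = f;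
  compm1 : forall A B (f : hom A B), comp f (idm A) = f;
  compA : forall A B D E (h : hom D E) (g : hom B D) (f : hom A B),
    comp h (comp g f) = comp (comp h g) f;
  compDl : forall A B D (g g' : hom B D) (f : hom A B),
    comp (g + g') f = comp g f + comp g' f;
  compDr : forall A B D (g : hom B D) (f f' : hom A B),
    comp g (f + f') = comp g f + comp g f'
}.

Arguments idm {p} A : rename.
Arguments comp {p A B D} g f : rename.

Notation "g \co f" := (comp g f) (at level 40, left associativity) : ring_scope.

Section Preadditive.
Variable C : preadditive.
Implicit Types A B D X : C.

Lemma comp0m A B D (f : hom A B) : (0 : hom B D) \co f = 0.
Proof. by apply: (addrI (0 \co f)); rewrite -compDl !addr0. Qed.

Lemma compm0 A B D (g : hom B D) : g \co (0 : hom A B) = 0.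
Proof. by apply: (addrI (g \co 0)); rewrite -compDr !addr0. Qed.

Lemma compNm A B D (g : hom B D) (f : hom A B) : (- g) \co f = - (g \co f).
Proof. by apply: (addrI (g \co f)); rewrite -compDl !subrr comp0m. Qed.

Lemma compmN A B D (g : hom B D) (f : hom A B) : g \co (- f) = - (g \co f).
Proof. by apply: (addrI (g \co f)); rewrite -compDr !subrr compm0. Qed.

Lemma compBl A B D (g g' : hom B D) (f : hom A B) :
  (g - g') \co f = g \co f - g' \co f.
Proof. by rewrite compDl compNm. Qed.

Lemma compBr A B D (g : hom B D) (f f' : hom A B) :
  g \co (f - f') = g \co f - g \co f'.
Proof. by rewrite compDr compmN. Qed.

Definition is_mono A B (f : hom A B) : Prop :=
  forall X (u v : hom X A), f \co u = f \co v -> u = v.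

Definition is_epi A B (f : hom A B) : Prop :=
  forall X (u v : hom B X), u \co f = v \co f -> u = v.

Definition is_kernel A B K (f : hom A B) (k : hom K A) : Prop :=
  f \co k = 0 /\
  forall X (h : hom X A), f \co h = 0 -> exists! u : hom X K, k \co u = h.

Definition is_cokernel A B Q (f : hom A B) (q : hom B Q) : Prop :=
  q \co f = 0 /\
  forall X (h : hom B X), h \co f = 0 -> exists! u : hom Q X, u \co q = h.

Definition is_zero_obj Z : Prop :=
  forall X, (forall u v : hom X Z, u = v) /\ (forall u v : hom Z X, u = v).

Definition is_biproduct A B P (i1 : hom A P) (i2 : hom B P)
    (p1 : hom P A) (p2 : hom P B) : Prop :=
  [/\ p1 \co i1 = idm A, p2 \co i2 = idm B, p1 \co i2 = 0, p2 \co i1 = 0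
    & i1 \co p1 + i2 \co p2 = idm P].

Record abelian : Prop := Abelian {
  abelian_zero : exists Z : C, is_zero_obj Z;
  abelian_biprod : forall A B, exists P (i1 : hom A P) (i2 : hom B P)
    (p1 : hom P A) (p2 : hom P B), is_biproduct i1 i2 p1 p2;
  abelian_ker : forall A B (f : hom A B), exists K (k : hom K A),
    is_kernel f k;
  abelian_coker : forall A B (f : hom A B), exists Q (q : hom B Q),
    is_cokernel f q;
  abelian_mono : forall A B (f : hom A B), is_mono f ->
    exists D (g : hom B D), is_kernel g f;
  abelian_epi : forall A B (f : hom A B), is_epi f ->
    exists D (g : hom D A), is_cokernel g f
}.

(* f = k \co p with p epic and k monic is the image factorization of f, so    *)
(* this says that the image of f is a kernel of g.                            *)
Definition exact A B D (f : hom A B) (g : hom B D) : Prop :=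
  exists X (p : hom A X) (k : hom X B),
    [/\ is_epi p, is_kernel g k & f = k \co p].

Definition short_exact A B D (f : hom A B) (g : hom B D) : Prop :=
  [/\ is_mono f, exact f g & is_epi g].

Definition injective_obj J : Prop :=
  forall A B (m : hom A B) (f : hom A J), is_mono m ->
    exists g : hom B J, g \co m = f.

Definition enough_injectives : Prop :=
  forall A, exists J (m : hom A J), injective_obj J /\ is_mono m.

Lemma kernel_mono A B K (f : hom A B) (k : hom K A) : is_kernel f k -> is_mono k.
Proof.
move=> [fk0 kP] X u v kuv.
have [|w [_ wP]] := kP X (k \co u); first by rewrite compA fk0 comp0m.
by rewrite -(wP u) // -(wP v).
Qed.

Lemma cokernel_epi A B Q (f : hom A B) (q : hom B Q) :
  is_cokernel f q -> is_epi q.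
Proof.
move=> [qf0 qP] X u v uvq.
have [|w [_ wP]] := qP X (u \co q); first by rewrite -compA qf0 compm0.
by rewrite -(wP u) // -(wP v).
Qed.

Record inj_resolution B := InjResolution {
  rI : nat -> C;
  raug : hom B (rI 0);
  rd : forall i, hom (rI i) (rI i.+1);
  rI_injective : forall i, injective_obj (rI i);
  raug_mono : is_mono raug;
  raug_exact : exact raug (rd 0);
  rd_exact : forall i, exact (rd i) (rd i.+1)
}.

(* [sig_obj B Z] is Sigma^0 B, Sigma^1 B, ... when [Z] lists the terms        *)
(* Sigma^1 B, Sigma^2 B, ...; thus Sigma^0 B is B by computation.             *)
Definition sig_obj B (Z : nat -> C) (i : nat) : C :=
  if i is j.+1 then Z j else B.

Definition sig_m B (R : inj_resolution B) (Z : nat -> C)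
    (mS : forall i, hom (Z i) (rI R i.+1)) (i : nat) :
    hom (sig_obj B Z i) (rI R i) :=
  match i with 0 => raug R | j.+1 => mS j end.

(* An injective resolution of B with a choice of the cosyzygies Sigma^i B:    *)
(* [cZ i] is Sigma^(i+1) B, [ce i] is e_i, [cmS i] is m_(i+1).                *)
Record cosyzygies B := Cosyzygies {
  cres : inj_resolution B;
  cZ : nat -> C;
  ce : forall i, hom (rI cres i) (cZ i);
  cmS : forall i, hom (cZ i) (rI cres i.+1);
  ce_coker : forall i, is_cokernel (sig_m cmS i) (ce i);
  cmS_mono : forall i, is_mono (cmS i);
  cd_fact : forall i, rd cres i = cmS i \co ce i
}.

Section Tower.
Variables (B : C) (T : cosyzygies B).

Definition Inj (i : nat) : C := rI (cres T) i.
Definition Sig (i : nat) : C := sig_obj B (cZ T) i.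
Definition d_ (i : nat) : hom (Inj i) (Inj i.+1) := rd (cres T) i.
Definition m_ (i : nat) : hom (Sig i) (Inj i) := sig_m (@cmS B T) i.
Definition e_ (i : nat) : hom (Inj i) (Sig i.+1) := ce T i.

Lemma Inj_injective i : injective_obj (Inj i).
Proof. exact: rI_injective. Qed.

Lemma m_mono i : is_mono (m_ i).
Proof. by case: i => [|i]; [exact: raug_mono | exact: cmS_mono]. Qed.

Lemma e_coker i : is_cokernel (m_ i) (e_ i).
Proof. exact: ce_coker. Qed.

Lemma em0 i : e_ i \co m_ i = 0.
Proof. by have [] := e_coker i. Qed.

Lemma d_fact i : d_ i = m_ i.+1 \co e_ i.
Proof. exact: cd_fact. Qed.

End Tower.

Record embedding_step X := EmbeddingStep {
  stI : C; stZ : C; stm : hom X stI; ste : hom stI stZ;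
  stI_injective : injective_obj stI;
  stm_mono : is_mono stm;
  ste_coker : is_cokernel stm ste
}.

Lemma embedding_step_exists :
  abelian -> enough_injectives -> forall X, inhabited (embedding_step X).
Proof.
move=> ab ei X; have [J [m [injJ mm]]] := ei X.
have [Q [q qP]] := abelian_coker ab m.
by exists; exact: (EmbeddingStep injJ mm qP).
Qed.

Lemma mono_kernel_of_cokernel A B Q (m : hom A B) (q : hom B Q) :
  abelian -> is_mono m -> is_cokernel m q -> is_kernel q m.
Proof.
move=> ab mm [qm0 qP]; split=> // X h qh0.
have [D [g [gm0 gP]]] := abelian_mono ab mm.
have [w [wE _]] := qP D g gm0.
by apply: gP; rewrite -wE -compA qh0 compm0.
Qed.

Lemma is_kernel_mono_comp A B D K (m : hom B D) (f : hom A B) (k : hom K A) :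
  is_mono m -> is_kernel f k -> is_kernel (m \co f) k.
Proof.
move=> mm [fk0 kP]; split=> [|X h]; first by rewrite -compA fk0 compm0.
by rewrite -compA => mfh; apply: kP; apply: mm; rewrite mfh compm0.
Qed.

Lemma cosyzygies_exist :
  abelian -> enough_injectives -> forall B, inhabited (cosyzygies B).
Proof.
move=> ab ei B.
have [st] : inhabited (forall X, embedding_step X).
  exists=> X; suff: {_ : embedding_step X | True} by case.
  by apply: cid; have [s] := embedding_step_exists ab ei X; exists s.
pose X i := iter i (fun X => stZ (st X)) B.
pose I i := stI (st (X i)).
pose m i : hom (X i) (I i) := stm (st (X i)).
pose e i : hom (I i) (X i.+1) := ste (st (X i)).
have mm i : is_mono (m i) by exact: stm_mono.
have ec i : is_cokernel (m i) (e i) by exact: ste_coker.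
have mk i : is_kernel (m i.+1 \co e i) (m i).
  by apply: is_kernel_mono_comp => //; exact: mono_kernel_of_cokernel.
have injI i : injective_obj (I i) by exact: stI_injective.
have ex0 : exact (m 0%N) (m 1%N \co e 0%N).
  by exists (X 0%N), (idm _), (m 0%N); split; rewrite ?compm1 // => Y u v;
     rewrite !compm1.
have exS i : exact (m i.+1 \co e i) (m i.+2 \co e i.+1).
  by exists (X i.+1), (e i), (m i.+1); split=> //; exact: cokernel_epi (ec i).
exists; pose R := @InjResolution B I (m 0%N) (fun i => m i.+1 \co e i)
  injI (mm 0%N) ex0 exS.
have ecR i : is_cokernel (sig_m (R := R) (fun i => m i.+1) i) (e i).
  by case: i => [|i]; [exact: (ec 0%N) | exact: (ec i.+1)].
exact: (@Cosyzygies B R (fun i => X i.+1) e (fun i => m i.+1) ecR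
  (fun i => mm i.+1) (fun i => erefl)).
Qed.

Section Lifts.

Definition extend J A B (injJ : injective_obj J) (m : hom A B) (mm : is_mono m)
    (f : hom A J) : {g : hom B J | g \co m = f} := cid (injJ A B m f mm).

Lemma cokernel_factor_ex A B Q X (f : hom A B) (q : hom B Q) (h : hom B X) :
  is_cokernel f q -> h \co f = 0 -> exists u : hom Q X, u \co q = h.
Proof. by move=> [_ qP] /qP[u [uP _]]; exists u. Qed.

Definition factor A B Q X (f : hom A B) (q : hom B Q) (h : hom B X)
    (cq : is_cokernel f q) (hf0 : h \co f = 0) : {u : hom Q X | u \co q = h} :=
  cid (cokernel_factor_ex cq hf0).

Variables (A B : C) (TA : cosyzygies A) (TB : cosyzygies B).

Record is_lift (f : hom A B) (s : forall i, hom (Sig TA i) (Sig TB i))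
    (g : forall i, hom (Inj TA i) (Inj TB i)) : Prop := IsLift {
  lift0 : s 0%N = f;
  lift_m : forall i, g i \co m_ TA i = m_ TB i \co s i;
  lift_e : forall i, s i.+1 \co e_ TA i = e_ TB i \co g i
}.

Definition lift_g_of i (s : hom (Sig TA i) (Sig TB i)) :
    {g : hom (Inj TA i) (Inj TB i) | g \co m_ TA i = m_ TB i \co s} :=
  extend (@Inj_injective _ TB i) (@m_mono _ TA i) (m_ TB i \co s).

Lemma lift_s_subproof i (s : hom (Sig TA i) (Sig TB i)) :
  (e_ TB i \co sval (lift_g_of s)) \co m_ TA i = 0.
Proof. by rewrite -compA (svalP (lift_g_of s)) compA em0 comp0m. Qed.

Definition lift_s_of i (s : hom (Sig TA i) (Sig TB i)) :
    {s' : hom (Sig TA i.+1) (Sig TB i.+1)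
        | s' \co e_ TA i = e_ TB i \co sval (lift_g_of s)} :=
  factor (e_coker TA i) (lift_s_subproof s).

Variable f : hom A B.

Fixpoint lift_s (i : nat) : hom (Sig TA i) (Sig TB i) :=
  match i with
  | 0 => f
  | j.+1 => sval (lift_s_of (lift_s j))
  end.

Definition lift_g (i : nat) : hom (Inj TA i) (Inj TB i) :=
  sval (lift_g_of (lift_s i)).

Lemma liftP : is_lift f lift_s lift_g.
Proof.
split=> // i; first exact: (svalP (lift_g_of (lift_s i))).
exact: (svalP (lift_s_of (lift_s i))).
Qed.

End Lifts.

Lemma is_lift_id A (TA : cosyzygies A) :
  @is_lift A A TA TA (idm A) (fun i => idm _) (fun i => idm _).
Proof. by split=> // i; rewrite comp1m compm1. Qed.

Lemma is_lift_comp A B D (TA : cosyzygies A) (TB : cosyzygies B)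
    (TD : cosyzygies D) f s g f' s' g' :
  @is_lift A B TA TB f s g -> @is_lift B D TB TD f' s' g' ->
  @is_lift A D TA TD (f' \co f) (fun i => s' i \co s i) (fun i => g' i \co g i).
Proof.
move=> [s0 gm se] [s0' gm' se']; split=> [|i|i]; first by rewrite s0 s0'.
  by rewrite -compA gm compA gm' compA.
by rewrite -compA se compA se' compA.
Qed.

Lemma is_lift_add A B (TA : cosyzygies A) (TB : cosyzygies B) f s g f' s' g' :
  @is_lift A B TA TB f s g -> @is_lift A B TA TB f' s' g' ->
  @is_lift A B TA TB (f + f') (fun i => s i + s' i) (fun i => g i + g' i).
Proof.
move=> [s0 gm se] [s0' gm' se']; split=> [|i|i]; first by rewrite s0 s0'.
  by rewrite compDl compDr gm gm'.
by rewrite compDl compDr se se'.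
Qed.

Lemma is_lift_sub A B (TA : cosyzygies A) (TB : cosyzygies B) f s g s' g' :
  @is_lift A B TA TB f s g -> @is_lift A B TA TB f s' g' ->
  @is_lift A B TA TB 0 (fun i => s i - s' i) (fun i => g i - g' i).
Proof.
move=> [s0 gm se] [s0' gm' se']; split=> [|i|i]; first by rewrite s0 s0' subrr.
  by rewrite compBl compBr gm gm'.
by rewrite compBl compBr se se'.
Qed.

Lemma is_lift_null A B (TA : cosyzygies A) (TB : cosyzygies B) s g :
    @is_lift A B TA TB 0 s g ->
  [/\ s 0%N = 0,
      (forall i, exists h, s i.+1 = e_ TB i \co h),
      exists k, g 0%N = k \co e_ TA 0
    & forall i, exists h k, g i.+1 = d_ TB i \co h + k \co e_ TA i.+1].
Proof.
move=> [s0 gm se].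
have [k0 g0P] : exists k, k \co e_ TA 0 = g 0%N.
  by apply: cokernel_factor_ex (e_coker TA 0) _; rewrite gm s0 compm0.
have sP i : exists h, s i.+1 = e_ TB i \co h.
  elim: i => [|i [h sE]].
    exists k0; apply: (cokernel_epi (e_coker TA 0)).
    by rewrite se -g0P compA.
  have [h' hE] := Inj_injective h (@m_mono _ TA i.+1).
  pose r := g i.+1 - m_ TB i.+1 \co (e_ TB i \co h').
  have rm0 : r \co m_ TA i.+1 = 0.
    by rewrite compBl gm sE -!compA hE subrr.
  have [k kE] := cokernel_factor_ex (e_coker TA i.+1) rm0.
  exists k; apply: (cokernel_epi (e_coker TA i.+1)).
  by rewrite se -compA kE compBr compA em0 comp0m subr0.
split=> //; first by exists k0.
move=> i; have [h sE] := sP i.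
have [h' hE] := Inj_injective h (@m_mono _ TA i.+1).
pose r := g i.+1 - d_ TB i \co h'.
have rm0 : r \co m_ TA i.+1 = 0.
  by rewrite compBl gm sE d_fact -!compA hE subrr.
have [k kE] := cokernel_factor_ex (e_coker TA i.+1) rm0.
by exists h', k; rewrite kE addrC subrK.
Qed.

Record cofunctor := Cofunctor {
  fobj :> C -> zmodType;
  fmap : forall A B, hom A B -> {additive fobj B -> fobj A};
  fmap1 : forall A (x : fobj A), fmap (idm A) x = x;
  fmapM : forall A B D (g : hom B D) (f : hom A B) (x : fobj D),
    fmap (g \co f) x = fmap f (fmap g x);
  fmapD : forall A B (f g : hom A B) (x : fobj B),
    fmap (f + g) x = fmap f x + fmap g x
}.

Record nattrans (F G : cofunctor) := Nattrans {
  nt :> forall B, {additive F B -> G B};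
  nt_natural : forall A B (f : hom A B) (x : F B),
    nt A (fmap F f x) = fmap G f (nt B x)
}.

(* Kernels, images and cokernels of natural transformations are computed      *)
(* objectwise.                                                                *)
Definition nt_monic F G (u : nattrans F G) : Prop := forall B, injective (u B).

Definition nt_epic F G (u : nattrans F G) : Prop :=
  forall B, surjective_map (u B).

Definition nt_iso F G (u : nattrans F G) : Prop :=
  exists v : nattrans G F, forall B, cancel (u B) (v B) /\ cancel (v B) (u B).

Definition nt_comp0 F G H (u : nattrans F G) (v : nattrans G H) : Prop :=
  forall B x, v B (u B x) = 0.

Definition nt_exact F G H (u : nattrans F G) (v : nattrans G H) : Prop :=
  forall B, exact_ab (u B) (v B).

Definition zero_functor (F : cofunctor) : Prop := forall B (x : F B), x = 0.

Definition half_exact (F : cofunctor) : Prop :=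
  forall A B D (f : hom A B) (g : hom B D), short_exact f g ->
    exact_ab (fmap F g) (fmap F f).

Definition right_exact (F : cofunctor) : Prop :=
  forall A B D (f : hom A B) (g : hom B D), is_mono f -> exact f g ->
    exact_ab (fmap F g) (fmap F f) /\ surjective_map (fmap F f).

Definition epi_to_mono (F : cofunctor) : Prop :=
  forall A B (f : hom A B), is_epi f -> injective (fmap F f).

Definition mono_to_epi (F : cofunctor) : Prop :=
  forall A B (f : hom A B), is_mono f -> surjective_map (fmap F f).

Lemma fmap0 (F : cofunctor) A B (x : F B) : fmap F (0 : hom A B) x = 0.
Proof.
by apply: (addrI (fmap F (0 : hom A B) x)); rewrite -fmapD !addr0.
Qed.

Lemma fmapB (F : cofunctor) A B (f g : hom A B) (x : F B) :
  fmap F (f - g) x = fmap F f x - fmap F g x.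
Proof. by apply: (addIr (fmap F g x)); rewrite -fmapD !subrK. Qed.

Section FundamentalSequence.
Variables (F : cofunctor) (T : forall B, cosyzygies B).

Local Notation I_ B i := (Inj (T B) i).
Local Notation S_ B i := (Sig (T B) i).
Local Notation Fd B i := (fmap F (d_ (T B) i)).
Local Notation Fm B i := (fmap F (m_ (T B) i)).
Local Notation Fe B i := (fmap F (e_ (T B) i)).
Local Notation Ls f := (lift_s (T _) (T _) f).
Local Notation Lg f := (lift_g (T _) (T _) f).

Lemma FmFe B i x : Fe B i (Fm B i.+1 x) = Fd B i x.
Proof. by rewrite -fmapM -d_fact. Qed.

Lemma FeFm B i x : Fm B i (Fe B i x) = 0.
Proof. by rewrite -fmapM em0 fmap0. Qed.

Lemma FdFe B i x : Fd B i (Fe B i.+1 x) = 0.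
Proof. by rewrite -FmFe FeFm raddf0. Qed.

Lemma FdFd B i x : Fd B i (Fd B i.+1 x) = 0.
Proof. by rewrite -(FmFe x) FdFe. Qed.

Definition sat_obj (i : nat) (B : C) : zmodType :=
  match i with
  | 0 => F B
  | j.+1 => ker (Fe B j)
  end.

Definition sat_inc (i : nat) (B : C) : {additive sat_obj i B -> F (S_ B i)} :=
  match i return {additive sat_obj i B -> F (S_ B i)} with
  | 0 => (idfun : F B -> F B)
  | j.+1 => ker_inc (Fe B j)
  end.

Lemma sat_inc_inj i B : injective (sat_inc i B).
Proof. by case: i => [|i] //; exact: ker_inc_inj. Qed.

Lemma sat_map_subproof j A B (f : hom A B) (x : ker (Fe B j)) :
  Fe A j (fmap F (Ls f j.+1) (ker_inc (Fe B j) x)) = 0.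
Proof. by rewrite -fmapM (lift_e (liftP _ _ f)) fmapM ker_incP raddf0. Qed.

Definition sat_map (i : nat) A B (f : hom A B) :
    {additive sat_obj i B -> sat_obj i A} :=
  match i return {additive sat_obj i B -> sat_obj i A} with
  | 0 => fmap F f
  | j.+1 => @ker_lift _ _ (Fe A j) _ (fmap F (Ls f j.+1) \o ker_inc (Fe B j))
              (sat_map_subproof f)
  end.

Lemma sat_inc_map i A B (f : hom A B) x :
  sat_inc i A (sat_map i f x) = fmap F (Ls f i) (sat_inc i B x).
Proof. by case: i x. Qed.

Lemma sat_lift_uniq i A B (f : hom A B) s g s' g' (x : sat_obj i B) :
  @is_lift A B (T A) (T B) f s g -> @is_lift A B (T A) (T B) f s' g' ->
  fmap F (s i) (sat_inc i B x) = fmap F (s' i) (sat_inc i B x).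
Proof.
move=> l l'; have [s0 sP _ _] := is_lift_null (is_lift_sub l l').
apply/eqP; rewrite -subr_eq0 -fmapB; apply/eqP.
case: i x => [|i] x; first by rewrite s0 fmap0.
by have [h ->] := sP i; rewrite fmapM ker_incP raddf0.
Qed.

Lemma sat_fmap1 i A (x : sat_obj i A) : sat_map i (idm A) x = x.
Proof.
apply: sat_inc_inj; rewrite sat_inc_map.
by rewrite (sat_lift_uniq x (liftP _ _ _) (is_lift_id _)) fmap1.
Qed.

Lemma sat_fmapM i A B D (g : hom B D) (f : hom A B) (x : sat_obj i D) :
  sat_map i (g \co f) x = sat_map i f (sat_map i g x).
Proof.
apply: sat_inc_inj; rewrite !sat_inc_map -fmapM.
exact: sat_lift_uniq (liftP _ _ _) (is_lift_comp (liftP _ _ f) (liftP _ _ g)).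
Qed.

Lemma sat_fmapD i A B (f g : hom A B) (x : sat_obj i B) :
  sat_map i (f + g) x = sat_map i f x + sat_map i g x.
Proof.
apply: sat_inc_inj; rewrite raddfD !sat_inc_map -fmapD.
exact: sat_lift_uniq (liftP _ _ _) (is_lift_add (liftP _ _ f) (liftP _ _ g)).
Qed.

Definition satellite (i : nat) : cofunctor :=
  match i with
  | 0 => F
  | j.+1 => Cofunctor (@sat_fmap1 j.+1) (@sat_fmapM j.+1) (@sat_fmapD j.+1)
  end.


(* The quot-stabilization vanishes on injectives, so its value on Sigma^i B   *)
(* can be computed with the embedding m_i into the injective I^i.             *)

Definition qstab_obj (i : nat) (B : C) : zmodType := coker (Fm B i).

Definition qstab_pi (i : nat) (B : C) : {additive F (S_ B i) -> qstab_obj i B} :=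
  coker_pi (Fm B i).

Lemma qstab_map_subproof i A B (f : hom A B) (x : F (I_ B i)) :
  (qstab_pi i A \o fmap F (Ls f i)) (Fm B i x) = 0.
Proof.
apply/coker_pi_eq0; exists (fmap F (Lg f i) x).
by rewrite -!fmapM (lift_m (liftP _ _ f)).
Qed.

Definition qstab_map (i : nat) A B (f : hom A B) :
    {additive qstab_obj i B -> qstab_obj i A} :=
  coker_desc (qstab_map_subproof f).

Lemma qstab_map_pi i A B (f : hom A B) x :
  qstab_map i f (qstab_pi i B x) = qstab_pi i A (fmap F (Ls f i) x).
Proof. exact: coker_desc_pi. Qed.

Lemma qstab_lift_uniq i A B (f : hom A B) s g s' g' (x : F (S_ B i)) :
  @is_lift A B (T A) (T B) f s g -> @is_lift A B (T A) (T B) f s' g' ->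
  qstab_pi i A (fmap F (s i) x) = qstab_pi i A (fmap F (s' i) x).
Proof.
move=> l l'; apply/coker_pi_eq; rewrite -fmapB.
have [s0 sP _ _] := is_lift_null (is_lift_sub l l').
case: i x => [|i] x; first by exists 0; rewrite s0 fmap0 raddf0.
have [h ->] := sP i.
have [h' <-] := Inj_injective h (@m_mono _ (T A) i.+1).
by exists (fmap F (e_ (T B) i \co h') x); rewrite -fmapM compA.
Qed.

Lemma qstab_fmap1 i A (x : qstab_obj i A) : qstab_map i (idm A) x = x.
Proof.
have [y <-] := coker_pi_surj x; rewrite -/(qstab_pi i A) qstab_map_pi.
by rewrite (qstab_lift_uniq y (liftP _ _ _) (is_lift_id _)) fmap1.
Qed.

Lemma qstab_fmapM i A B D (g : hom B D) (f : hom A B) (x : qstab_obj i D) :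
  qstab_map i (g \co f) x = qstab_map i f (qstab_map i g x).
Proof.
have [y <-] := coker_pi_surj x; rewrite -/(qstab_pi i D) !(qstab_map_pi _ y).
rewrite (qstab_map_pi f (fmap F (Ls g i) y)) -fmapM.
exact: qstab_lift_uniq (liftP _ _ _) (is_lift_comp (liftP _ _ f) (liftP _ _ g)).
Qed.

Lemma qstab_fmapD i A B (f g : hom A B) (x : qstab_obj i B) :
  qstab_map i (f + g) x = qstab_map i f x + qstab_map i g x.
Proof.
have [y <-] := coker_pi_surj x; rewrite -/(qstab_pi i B) !(qstab_map_pi _ y).
rewrite -(raddfD (qstab_pi i A)) -fmapD.
exact: qstab_lift_uniq (liftP _ _ _) (is_lift_add (liftP _ _ f) (liftP _ _ g)).
Qed.

Definition quot_stab_Sigma (i : nat) : cofunctor :=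
  Cofunctor (@qstab_fmap1 i) (@qstab_fmapM i) (@qstab_fmapD i).

Definition quot_stab : cofunctor := quot_stab_Sigma 0.

(* F(d_(i-1)); for i = 0 it is the zero map, whose kernel is all of F(I^0).   *)

Definition Fdprev (i : nat) (B : C) : {additive F (I_ B i) -> F (I_ B i.-1)} :=
  match i return {additive F (I_ B i) -> F (I_ B i.-1)} with
  | 0 => \0
  | j.+1 => Fd B j
  end.

Definition cyc (i : nat) (B : C) : zmodType := ker (Fdprev i B).

Definition cyc_inc (i : nat) (B : C) : {additive cyc i B -> F (I_ B i)} :=
  ker_inc (Fdprev i B).

Lemma Fdprev_Fe i B x : Fdprev i B (Fe B i x) = 0.
Proof. by case: i x => [|i] x //; exact: FdFe. Qed.

Lemma Fdprev_Fd i B x : Fdprev i B (Fd B i x) = 0.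
Proof. by rewrite -FmFe Fdprev_Fe. Qed.

Lemma Fdprev_map i A B (f : hom A B) (x : cyc i B) :
  Fdprev i A ((fmap F (Lg f i) \o cyc_inc i B) x) = 0.
Proof.
case: i x => [|i] x //=; rewrite -fmapM.
have l := liftP (T A) (T B) f.
rewrite d_fact compA (lift_m l) -compA (lift_e l) compA -d_fact fmapM.
by rewrite (ker_incP x) raddf0.
Qed.

Definition cyc_map (i : nat) A B (f : hom A B) :
    {additive cyc i B -> cyc i A} := ker_lift (@Fdprev_map i A B f).

Definition bnd (i : nat) (B : C) : {additive F (I_ B i.+1) -> cyc i B} :=
  ker_lift (@Fdprev_Fd i B).

Definition lder_obj (i : nat) (B : C) : zmodType := coker (bnd i B).

Definition lder_pi (i : nat) (B : C) : {additive cyc i B -> lder_obj i B} :=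
  coker_pi (bnd i B).

Lemma lder_map_subproof i A B (f : hom A B) (x : F (I_ B i.+1)) :
  (lder_pi i A \o cyc_map i f) (bnd i B x) = 0.
Proof.
apply/coker_pi_eq0; exists (fmap F (Lg f i.+1) x).
apply: ker_inc_inj; rewrite !ker_inc_lift /= -!fmapM.
have l := liftP (T A) (T B) f.
by rewrite !d_fact compA (lift_m l) -compA (lift_e l) compA.
Qed.

Definition lder_map (i : nat) A B (f : hom A B) :
    {additive lder_obj i B -> lder_obj i A} :=
  coker_desc (lder_map_subproof f).

Lemma lder_map_pi i A B (f : hom A B) x :
  lder_map i f (lder_pi i B x) = lder_pi i A (cyc_map i f x).
Proof. exact: coker_desc_pi. Qed.

Lemma lder_lift_uniq i A B (f : hom A B) s g s' g' (x : cyc i B)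
    (y y' : cyc i A) :
  @is_lift A B (T A) (T B) f s g -> @is_lift A B (T A) (T B) f s' g' ->
  cyc_inc i A y = fmap F (g i) (cyc_inc i B x) ->
  cyc_inc i A y' = fmap F (g' i) (cyc_inc i B x) ->
  lder_pi i A y = lder_pi i A y'.
Proof.
move=> l l' yE y'E; apply/coker_pi_eq.
suff [z zE] : exists z, Fd A i z = cyc_inc i A (y - y').
  by exists z; apply: ker_inc_inj.
rewrite raddfB yE y'E -fmapB.
have [_ _ g0 gP] := is_lift_null (is_lift_sub l l').
have ext k : exists z, Fd A i z = fmap F (k \co e_ (T A) i) (cyc_inc i B x).
  have [k' <-] := Inj_injective k (@m_mono _ (T A) i.+1).
  by exists (fmap F k' (cyc_inc i B x)); rewrite -compA -d_fact fmapM.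
case: i x y y' yE y'E ext => [|i] x y y' _ _ ext.
  by have [k ->] := g0; exact: ext.
have [h [k ->]] := gP i.
by rewrite fmapD (fmapM (d_ _ _)) (ker_incP x) raddf0 add0r; exact: ext.
Qed.

Lemma lder_fmap1 i A (x : lder_obj i A) : lder_map i (idm A) x = x.
Proof.
have [y <-] := coker_pi_surj x; rewrite -/(lder_pi i A) lder_map_pi.
by apply: lder_lift_uniq (liftP _ _ _) (is_lift_id _) _ _; rewrite ?fmap1.
Qed.

Lemma lder_fmapM i A B D (g : hom B D) (f : hom A B) (x : lder_obj i D) :
  lder_map i (g \co f) x = lder_map i f (lder_map i g x).
Proof.
have [y <-] := coker_pi_surj x; rewrite -/(lder_pi i D) !(lder_map_pi _ y).
rewrite (lder_map_pi f (cyc_map i g y)).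
apply: lder_lift_uniq (liftP _ _ _) (is_lift_comp (liftP _ _ f) (liftP _ _ g)) _ _.
  by [].
by rewrite fmapM.
Qed.

Lemma lder_fmapD i A B (f g : hom A B) (x : lder_obj i B) :
  lder_map i (f + g) x = lder_map i f x + lder_map i g x.
Proof.
have [y <-] := coker_pi_surj x; rewrite -/(lder_pi i B) !(lder_map_pi _ y).
rewrite -(raddfD (lder_pi i A)).
apply: lder_lift_uniq (liftP _ _ _) (is_lift_add (liftP _ _ f) (liftP _ _ g)) _ _.
  by [].
by rewrite raddfD fmapD.
Qed.

Definition left_derived (i : nat) : cofunctor :=
  Cofunctor (@lder_fmap1 i) (@lder_fmapM i) (@lder_fmapD i).

Lemma cyc_to_sat_subproof j B (x : cyc j.+1 B) :
  Fe B j ((Fm B j.+1 \o cyc_inc j.+1 B) x) = 0.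
Proof. by rewrite /= FmFe (ker_incP x). Qed.

Definition cyc_to_sat (i : nat) (B : C) : {additive cyc i B -> sat_obj i B} :=
  match i return {additive cyc i B -> sat_obj i B} with
  | 0 => Fm B 0 \o cyc_inc 0 B
  | j.+1 => ker_lift (@cyc_to_sat_subproof j B)
  end.

Lemma sat_inc_cyc i B (x : cyc i B) :
  sat_inc i B (cyc_to_sat i B x) = Fm B i (cyc_inc i B x).
Proof. by case: i x. Qed.

Lemma cyc_to_sat_bnd i B (x : F (I_ B i.+1)) : cyc_to_sat i B (bnd i B x) = 0.
Proof.
apply: (@sat_inc_inj i); rewrite raddf0 sat_inc_cyc ker_inc_lift.
by rewrite -FmFe FeFm.
Qed.

Definition lder_to_sat_at (i : nat) (B : C) :
    {additive lder_obj i B -> sat_obj i B} :=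
  coker_desc (@cyc_to_sat_bnd i B).

Lemma lder_to_sat_pi i B (x : cyc i B) :
  lder_to_sat_at i B (lder_pi i B x) = cyc_to_sat i B x.
Proof. exact: coker_desc_pi. Qed.

Lemma lder_to_sat_natural i A B (f : hom A B) (x : lder_obj i B) :
  lder_to_sat_at i A (lder_map i f x) = sat_map i f (lder_to_sat_at i B x).
Proof.
have [y <-] := coker_pi_surj x; rewrite -/(lder_pi i B) (lder_map_pi f y).
rewrite !lder_to_sat_pi; apply: (@sat_inc_inj i).
rewrite sat_inc_map !sat_inc_cyc ker_inc_lift /= -!fmapM.
by rewrite (lift_m (liftP _ _ f)).
Qed.

Definition lder_to_sat (i : nat) : nattrans (left_derived i) (satellite i) :=
  match i with
  | 0 => @Nattrans (left_derived 0) F _ (@lder_to_sat_natural 0)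
  | j.+1 => @Nattrans (left_derived j.+1) (satellite j.+1) _
              (@lder_to_sat_natural j.+1)
  end.

Definition sat_to_qstab_at (i : nat) (B : C) :
    {additive sat_obj i B -> qstab_obj i B} := qstab_pi i B \o sat_inc i B.

Lemma sat_to_qstab_natural i A B (f : hom A B) (x : sat_obj i B) :
  sat_to_qstab_at i A (sat_map i f x) = qstab_map i f (sat_to_qstab_at i B x).
Proof.
by rewrite [LHS]/= sat_inc_map; exact/esym/qstab_map_pi.
Qed.

Definition sat_to_qstab (i : nat) : nattrans (satellite i) (quot_stab_Sigma i) :=
  match i with
  | 0 => @Nattrans F (quot_stab_Sigma 0) _ (@sat_to_qstab_natural 0)
  | j.+1 => @Nattrans (satellite j.+1) (quot_stab_Sigma j.+1) _
              (@sat_to_qstab_natural j.+1)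
  end.

Definition Sig_to_cyc (i : nat) (B : C) : {additive F (S_ B i.+1) -> cyc i B} :=
  ker_lift (@Fdprev_Fe i B).

Lemma Sig_to_lder_m i B (x : F (I_ B i.+1)) :
  (lder_pi i B \o Sig_to_cyc i B) (Fm B i.+1 x) = 0.
Proof.
apply/coker_pi_eq0; exists x; apply: ker_inc_inj.
by rewrite !ker_inc_lift FmFe.
Qed.

Definition qstab_to_lder_at (i : nat) (B : C) :
    {additive quot_stab_Sigma i.+1 B -> left_derived i B} :=
  coker_desc (@Sig_to_lder_m i B).

Lemma qstab_to_lder_pi i B (x : F (S_ B i.+1)) :
  qstab_to_lder_at i B (qstab_pi i.+1 B x) = lder_pi i B (Sig_to_cyc i B x).
Proof. exact: coker_desc_pi. Qed.

Lemma qstab_to_lder_natural i A B (f : hom A B) (x : quot_stab_Sigma i.+1 B) :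
  qstab_to_lder_at i A (fmap (quot_stab_Sigma i.+1) f x) =
  fmap (left_derived i) f (qstab_to_lder_at i B x).
Proof.
have [y <-] := coker_pi_surj x; rewrite -/(qstab_pi i.+1 B).
rewrite (qstab_map_pi f y) !qstab_to_lder_pi (lder_map_pi f).
congr (lder_pi i A _); apply: ker_inc_inj.
by rewrite !ker_inc_lift -!fmapM (lift_e (liftP _ _ f)) fmapM.
Qed.

Definition qstab_to_lder (i : nat) :
    nattrans (quot_stab_Sigma i.+1) (left_derived i) :=
  Nattrans (@qstab_to_lder_natural i).

Definition lambda_ : nattrans (left_derived 0) F := lder_to_sat 0.

Definition alpha_ : nattrans (quot_stab_Sigma 1) (left_derived 0) :=
  qstab_to_lder 0.

End FundamentalSequence.
End Preadditive.

(* Main.v *)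
(** Exactness away from the L^i F is a diagram chase from d_i = m_(i+1) e_i and
    e_i m_i = 0; at L^i F it amounts to the exactness of
    F(Sigma^(i+1) B) -> F(I^i) -> F(Sigma^i B).
    For (5), suppose that F(I^1) -> F(I^0) -> F(B) -> 0 is always exact, and
    let f : A -> B be a kernel of g : B -> D.  By injectivity there are
    a : I_A -> I_B and b : B -> I_A with a m_A = m_B f and b f = m_A.
    If z = F(m_B) w satisfies F(f) z = 0, then F(a) w = F(d_A) v for some v,
    and z = F(d_A b) v + F(m_B - a b) w.  Both d_A b and m_B - a b vanish on A
    and have injective codomain, so they factor through g, which puts z in the
    image of F(g). *)

Require Import Defs.
From HB Require Import structures.
From mathcomp Require Import all_boot all_algebra.

Set Implicit Arguments.
Unset Strict Implicit.
Unset Printing Implicit Defensive.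

(* Defs last: its [hom] and [comp] must not be shadowed by the library ones. *)
Import GRing.Theory Defs.
Local Open Scope ring_scope.

Lemma additive_injective (U V : zmodType) (f : {additive U -> V}) :
  (forall x, f x = 0 -> x = 0) -> injective f.
Proof.
move=> f0 x y fxy; apply/eqP; rewrite -subr_eq0; apply/eqP/f0.
by rewrite raddfB fxy subrr.
Qed.

(** * Extension of maps into injectives along exact sequences *)

Section Abelian.
Variables (C : preadditive) (abC : abelian C).
Implicit Types A B D J K Q X : C.

Lemma mono0P A B (f : hom A B) :
  (forall X (u : hom X A), f \co u = 0 -> u = 0) -> is_mono f.
Proof.
move=> f0 X u v fuv; apply/eqP; rewrite -subr_eq0; apply/eqP/f0.
by rewrite compBr fuv subrr.
Qed.

(** If [h \co t = 0], then [h] factors through the cokernel [c] of [t]. The epi [c \co q] is a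
    cokernel of some [s]; as [g] kills [s], [s] factors through [k] and [q] kills it. Hence [q]
    factors through [c \co q], so [c] is split monic and [t = 0]. *)
Lemma coimage_mono A B D Q (k : hom A B) (g : hom B D) (q : hom B Q)
    (h : hom Q D) :
  is_kernel g k -> is_cokernel k q -> h \co q = g -> is_mono h.
Proof.
move=> [_ kP] qP hq; apply: mono0P => X t ht0.
have [Y [c cP]] := abelian_coker abC t.
have [h' h'c] := cokernel_factor_ex cP ht0.
have epi_cq : is_epi (c \co q).
  move=> Z u v; rewrite !compA => uv.
  exact: (cokernel_epi cP) (cokernel_epi qP uv).
have [E [s sP]] := abelian_epi abC epi_cq.
have [cqs0 _] := sP.
have [|s' [ks' _]] := kP _ s.
  by rewrite -hq -h'c -(compA h') -(compA h') cqs0 compm0.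
have qs0 : q \co s = 0.
  by rewrite -ks' compA; have [-> _] := qP; rewrite comp0m.
have [r rcq] := cokernel_factor_ex sP qs0.
have rc1 : r \co c = idm Q.
  by apply: (cokernel_epi qP); rewrite comp1m -compA.
have [ct0 _] := cP.
by rewrite -(comp1m t) -rc1 -compA ct0 compm0.
Qed.

(** Since [u] kills the image [k] of [f], it descends to the cokernel of [k]. That cokernel embeds
    into [D], and injectivity of [J] extends the descended map. *)
Lemma injective_factor A B D J (f : hom A B) (g : hom B D) (u : hom B J) :
  exact f g -> injective_obj J -> u \co f = 0 -> exists u', u' \co g = u.
Proof.
move=> [K [p [k [epi_p kP fE]]]] injJ uf0.
have uk0 : u \co k = 0 by apply: epi_p; rewrite comp0m -compA -fE.
have [Q [q qP]] := abelian_coker abC k.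
have [gk0 _] := kP.
have [h hq] := cokernel_factor_ex qP gk0.
have [v vq] := cokernel_factor_ex qP uk0.
have [u' u'h] := injJ _ _ h v (coimage_mono kP qP hq).
by exists u'; rewrite -hq compA u'h.
Qed.

Lemma exact_comp0 A B D (f : hom A B) (g : hom B D) : exact f g -> g \co f = 0.
Proof. by move=> [X [p [k [_ [gk0 _] ->]]]]; rewrite compA gk0 comp0m. Qed.

Lemma short_exact_m_e B (T : cosyzygies B) i : short_exact (m_ T i) (e_ T i).
Proof.
split; [exact: m_mono | | exact: cokernel_epi (e_coker T i)].
exists (Sig T i), (idm _), (m_ T i); split; last by rewrite compm1.
- by move=> X u v; rewrite !compm1.
- exact: mono_kernel_of_cokernel abC (@m_mono _ _ T i) (e_coker T i).
Qed.

End Abelian.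

(** * Complex property and exactness, term by term *)

Section Sequence.
Variables (C : preadditive) (F : cofunctor C) (T : forall B : C, cosyzygies B).

Local Notation Fm B i := (fmap F (m_ (T B) i)).
Local Notation Fe B i := (fmap F (e_ (T B) i)).
Local Notation Fd B i := (fmap F (d_ (T B) i)).

(* [satellite i B] and [sat_obj i B] are convertible only once [i] is a
   constructor form. *)
Definition sat_val i B : {additive satellite F T i B -> F (Sig (T B) i)} :=
  match i return {additive satellite F T i B -> F (Sig (T B) i)} with
  | 0 => sat_inc F T 0 B
  | j.+1 => sat_inc F T j.+1 B
  end.

Lemma sat_val_inj i B : injective (sat_val i B).
Proof. by case: i => [|i]; exact: sat_inc_inj. Qed.

Lemma sat_val_lder i B x :
  sat_val i B (lder_to_sat F T i B (lder_pi F T i B x)) =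
  Fm B i (cyc_inc F T i B x).
Proof.
by case: i x => [|i] x; rewrite -sat_inc_cyc; congr (sat_inc _ _ _ _ _);
  exact: lder_to_sat_pi.
Qed.

Lemma sat_to_qstabE i B x :
  sat_to_qstab F T i B x = qstab_pi F T i B (sat_val i B x).
Proof. by case: i x. Qed.

Lemma lder_to_sat_comp0 i : nt_comp0 (lder_to_sat F T i) (sat_to_qstab F T i).
Proof.
move=> B x; have [y <-] := coker_pi_surj x; rewrite -/(lder_pi F T i B).
rewrite sat_to_qstabE sat_val_lder.
by apply/coker_pi_eq0; exists (cyc_inc F T i B y).
Qed.

Lemma lder_to_sat_exact i : nt_exact (lder_to_sat F T i) (sat_to_qstab F T i).
Proof.
move=> B x; split=> [|[y <-]]; last exact: lder_to_sat_comp0.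
rewrite sat_to_qstabE => /coker_pi_eq0[w wx].
(* For positive [i] this is F(d_(i-1)) = F(e_(i-1)) F(m_i); for [i = 0] every element is a cycle. *)
have cyc_w : Fdprev F T i B w = 0.
  by case: i x w wx => [|i] x w wx //=; rewrite -FmFe wx ker_incP.
have cyc_wP : ker_pred (Fdprev F T i B) w by apply/eqP.
exists (lder_pi F T i B (Ker cyc_wP)).
by apply: sat_val_inj; rewrite sat_val_lder.
Qed.

Lemma sat_to_qstab_comp0 i :
  nt_comp0 (sat_to_qstab F T i.+1) (qstab_to_lder F T i).
Proof.
(* F(e_i) kills S_(i+1)F, so the cycle itself is zero and bounds 0. *)
move=> B x; rewrite sat_to_qstabE qstab_to_lder_pi.
apply/coker_pi_eq0; exists 0; apply: ker_inc_inj.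
by rewrite raddf0 raddf0 ker_inc_lift ker_incP.
Qed.

(** A vanishing class means F(e_i) y = F(d_i) w = F(e_i) F(m_(i+1)) w. Both exactness at the
    quot-stabilization and monicity of [alpha_] start from this. *)
Lemma qstab_to_lder_eq0 i B (y : F (Sig (T B) i.+1)) :
  qstab_to_lder F T i B (qstab_pi F T i.+1 B y) = 0 ->
  exists w, Fe B i (y - Fm B i.+1 w) = 0.
Proof.
rewrite qstab_to_lder_pi => /coker_pi_eq0[w wy]; exists w.
move/(congr1 (cyc_inc F T i B)): wy; rewrite !ker_inc_lift => wy.
by rewrite raddfB FmFe wy subrr.
Qed.

Lemma sat_to_qstab_exact i :
  nt_exact (sat_to_qstab F T i.+1) (qstab_to_lder F T i).
Proof.
move=> B x; split=> [|[y <-]]; last exact: sat_to_qstab_comp0.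
have [y <-] := coker_pi_surj x; rewrite -/(qstab_pi F T i.+1 B).
move=> /qstab_to_lder_eq0[w wy].
have yP : ker_pred (Fe B i) (y - Fm B i.+1 w) by apply/eqP.
exists (Ker yP); rewrite sat_to_qstabE.
by apply/coker_pi_eq; exists (- w); rewrite raddfN /= addrAC subrr add0r.
Qed.

Lemma qstab_to_lder_comp0 i : nt_comp0 (qstab_to_lder F T i) (lder_to_sat F T i).
Proof.
move=> B x; have [y <-] := coker_pi_surj x; rewrite -/(qstab_pi F T i.+1 B).
rewrite qstab_to_lder_pi; apply: sat_val_inj.
by rewrite sat_val_lder raddf0 ker_inc_lift FeFm.
Qed.

(** Half-exactness is applied to the short exact sequence of [m_] and [e_]: a cycle killed by F(m_i)
    comes from F(e_i). *)
Lemma qstab_to_lder_exact (abC : abelian C) i :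
  half_exact F -> nt_exact (qstab_to_lder F T i) (lder_to_sat F T i).
Proof.
move=> hF B x; split=> [|[y <-]]; last exact: qstab_to_lder_comp0.
have [y <-] := coker_pi_surj x; rewrite -/(lder_pi F T i B).
move/(congr1 (sat_val i B)); rewrite sat_val_lder raddf0.
move/(hF _ _ _ _ _ (short_exact_m_e abC (T B) i)) => [z zy].
exists (qstab_pi F T i.+1 B z); rewrite qstab_to_lder_pi; congr (lder_pi F T i B _).
by apply: ker_inc_inj; rewrite ker_inc_lift.
Qed.

Lemma sat_to_qstab0_epic : nt_epic (sat_to_qstab F T 0).
Proof. by move=> B x; exact: coker_pi_surj. Qed.

(** * Monicity of [alpha_] and criteria for [lambda_] *)

Lemma alpha_monic : epi_to_mono F -> nt_monic (alpha_ F T).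
Proof.
move=> eF B; apply: additive_injective => x.
have [y <-] := coker_pi_surj x; rewrite -/(qstab_pi F T 1 B).
move=> /qstab_to_lder_eq0[w wy]; apply/coker_pi_eq0; exists w.
apply/eqP; rewrite eq_sym -subr_eq0; apply/eqP.
apply: (eF _ _ _ (cokernel_epi (e_coker (T B) 0))).
by rewrite wy raddf0.
Qed.

(** [Fdprev] is zero in degree 0, so L^0 F(B) is F(I^0) modulo the image of F(d_0), and [lambda_] is
    induced on it by F(m_0). *)
Lemma lambda_surjP B : surjective_map (lambda_ F T B) <-> surjective_map (Fm B 0).
Proof.
split=> sur x.
  have [y <-] := sur x; have [w <-] := coker_pi_surj y.
  rewrite -/(lder_pi F T 0 B).
  by exists (cyc_inc F T 0 B w); rewrite lder_to_sat_pi.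
have [w <-] := sur x; have wP : ker_pred (Fdprev F T 0 B) w by apply/eqP.
by exists (lder_pi F T 0 B (Ker wP)); rewrite lder_to_sat_pi.
Qed.

Lemma lambda_injP B : injective (lambda_ F T B) <-> exact_ab (Fd B 0) (Fm B 0).
Proof.
split=> [inj y | ex].
  split=> [Fmy | [x <-]]; last by rewrite -FmFe FeFm.
  have yP : ker_pred (Fdprev F T 0 B) y by apply/eqP.
  have : lder_pi F T 0 B (Ker yP) = 0.
    by apply: inj; rewrite raddf0 lder_to_sat_pi.
  by move=> /coker_pi_eq0[x xy]; exists x; move/(congr1 (cyc_inc F T 0 B)): xy.
apply: additive_injective => x; have [y <-] := coker_pi_surj x.
rewrite -/(lder_pi F T 0 B) lder_to_sat_pi => /ex[z zy].
by apply/coker_pi_eq0; exists z; apply: ker_inc_inj.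
Qed.

(** Extending m_0 of [A] along [f] to [g] gives F(m_0) = F(f) F(g), which is onto. *)
Lemma surjective_mono_to_epi :
  (forall B, surjective_map (Fm B 0)) -> mono_to_epi F.
Proof.
move=> sur A B f mf x; have [y <-] := sur A x.
have [g gf] := Inj_injective (m_ (T A) 0) mf.
by exists (fmap F g y); rewrite -fmapM gf.
Qed.

Lemma quot_stab_eq0 : mono_to_epi F -> zero_functor (quot_stab F T).
Proof.
move=> mF B x; have [y <-] := coker_pi_surj x.
exact/coker_pi_eq0/mF/(@m_mono _ _ (T B) 0).
Qed.

Lemma lambda_epic : mono_to_epi F -> nt_epic (lambda_ F T).
Proof. by move=> mF B; apply/lambda_surjP/mF/(@m_mono _ _ (T B) 0). Qed.

Lemma resolution_right_exact (abC : abelian C) :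
  (forall B, exact_ab (Fd B 0) (Fm B 0)) ->
  (forall B, surjective_map (Fm B 0)) -> right_exact F.
Proof.
move=> ex sur A B D f g mf exfg.
split; last exact: surjective_mono_to_epi sur _ _ _ mf.
move=> z; split=> [Ffz | [y <-]]; last first.
  by rewrite -fmapM (exact_comp0 exfg) fmap0.
have [w wz] := sur B z.
have [a aP] := Inj_injective (m_ (T B) 0 \co f) (@m_mono _ _ (T A) 0).
have [b bP] := Inj_injective (m_ (T A) 0) mf.
(* F(m_A) F(a) w = F(f) F(m_B) w = F(f) z = 0. *)
have [|v vP] := (ex A (fmap F a w)).1.
  by rewrite -fmapM aP fmapM wz.
pose u1 : hom B (Inj (T A) 1) := d_ (T A) 0 \co b.
pose u2 : hom B (Inj (T B) 0) := m_ (T B) 0 - a \co b.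
have u1f : u1 \co f = 0.
  by rewrite /u1 -compA bP d_fact -compA (em0 (T A) 0) compm0.
have u2f : u2 \co f = 0 by rewrite /u2 compBl -compA bP aP subrr.
have [c1 c1P] := injective_factor abC exfg (@Inj_injective _ _ (T A) 1) u1f.
have [c2 c2P] := injective_factor abC exfg (@Inj_injective _ _ (T B) 0) u2f.
exists (fmap F c1 v + fmap F c2 w).
(* F(b) F(d_A) v = F(b) F(a) w cancels the term of [a \co b] and leaves F(m_B) w = z. *)
rewrite raddfD -!fmapM c1P c2P /u1 /u2 (fmapM (d_ _ _)) vP fmapB.
by rewrite (fmapM a) wz addrC subrK.
Qed.

End Sequence.

(** Injectivity of [u] makes the chosen pointwise inverses additive and natural. *)
Lemma nt_isoP (C : preadditive) (F G : cofunctor C) (u : nattrans F G) :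
  nt_iso u <-> nt_monic u /\ nt_epic u.
Proof.
split=> [[v uv] | [mu eu]].
  split=> B; have [uK vK] := uv B; first exact: can_inj uK.
  by move=> y; exists (v B y).
pose vf B y := sval (boolp.cid (eu B y)).
have vK B : cancel (vf B) (u B) by move=> y; exact: svalP (boolp.cid (eu B y)).
have vB B : zmod_morphism (vf B).
  by move=> x y; apply: (mu B); rewrite raddfB !vK.
pose va B : {additive G B -> F B} :=
  HB.pack (vf B) (GRing.isZmodMorphism.Build _ _ (vf B) (vB B)).
have vn A B (f : hom A B) y : va A (fmap G f y) = fmap F f (va B y).
  by apply: (mu A); rewrite nt_natural /= !vK.
by exists (Nattrans vn) => B; split=> x /=; [apply: (mu B); rewrite vK | rewrite vK].
Qed.

Lemma lambda_isoP (C : preadditive) (abC : abelian C) (F : cofunctor C)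
    (T : forall B : C, cosyzygies B) :
  nt_iso (lambda_ F T) <-> right_exact F.
Proof.
split=> [/nt_isoP[mon epi] | rF].
  by apply: (resolution_right_exact (T := T)) => // B;
    [exact/lambda_injP | exact/lambda_surjP].
(* Right-exactness is used only on the start B -> I^0 -> I^1 of the resolution. *)
have ex B := rF _ _ _ _ _ (@raug_mono _ _ (cres (T B)))
  (raug_exact (cres (T B))).
by apply/nt_isoP; split=> B; [apply/lambda_injP | apply/lambda_surjP];
  have [] := ex B.
Qed.

Theorem theorem10p2 (C : preadditive) (abC : abelian C)
    (enough : enough_injectives C) (F : cofunctor C)
    (T : forall B : C, cosyzygies B) :
  [/\ [/\ forall i, nt_comp0 (lder_to_sat F T i) (sat_to_qstab F T i),
          forall i, nt_comp0 (sat_to_qstab F T i.+1) (qstab_to_lder F T i),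
          forall i, nt_comp0 (qstab_to_lder F T i) (lder_to_sat F T i)
        & [/\ forall i, nt_exact (lder_to_sat F T i) (sat_to_qstab F T i),
              forall i, nt_exact (sat_to_qstab F T i.+1) (qstab_to_lder F T i)
            & nt_epic (sat_to_qstab F T 0)]],
      half_exact F ->
      [/\ forall i, nt_exact (lder_to_sat F T i) (sat_to_qstab F T i),
          forall i, nt_exact (sat_to_qstab F T i.+1) (qstab_to_lder F T i),
          forall i, nt_exact (qstab_to_lder F T i) (lder_to_sat F T i)
        & nt_epic (sat_to_qstab F T 0)],
      epi_to_mono F -> nt_monic (alpha_ F T),
      mono_to_epi F -> zero_functor (quot_stab F T) /\ nt_epic (lambda_ F T)
    & nt_iso (lambda_ F T) <-> right_exact F].
Proof.
split; last exact: lambda_isoP.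
- split; last split.
  + exact: lder_to_sat_comp0.
  + exact: sat_to_qstab_comp0.
  + exact: qstab_to_lder_comp0.
  + exact: lder_to_sat_exact.
  + exact: sat_to_qstab_exact.
  + exact: sat_to_qstab0_epic.
- move=> hF; split.
  + exact: lder_to_sat_exact.
  + exact: sat_to_qstab_exact.
  + by move=> i; exact: qstab_to_lder_exact.
  + exact: sat_to_qstab0_epic.
- exact: alpha_monic.
- by move=> mF; split; [exact: quot_stab_eq0 | exact: lambda_epic].
Qed.
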